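(* There is a constant $\omega>0$ such that for every finite linearly ordered set $V$ with $|V|\ge 10$, every $p\ge 0$ and every function $g$ from the set of squares over $V$ to $\mu_2$: if $g$ fails the cube condition with probability at most $p$, then for at least one of the two functions $g_1\in\{g,\ [-1]\cdot g\}$ there are a sign $\epsilon\in\mu_2$ and a symmetric function $f$ (assigning to each unordered pair $\{i,j\}$ of distinct elements of $V$ a value $f_{ij}=f_{ji}\in\mu_2$) such that the function $g'_{ijk\ell}=\epsilon f_{ij}f_{kj}f_{k\ell}f_{i\ell}$ on squares satisfies $\Pr\{(g_1)_c\neq g'_c\}\le\omega^{-1}p$, where $c$ is a uniformly random square over $V$.
   Context: $\mu_2=\{1,-1\}$ (multiplicative group). A square ($2$-cell) over $V$ is a $4$-element subset of $V$ endowed with the graph structure of a $4$-cycle; $(ijk\ell)$ denotes the square with edges $ij, jk, k\ell,\ell i$, and $g_{ijk\ell}$ is the value of $g$ on it. A cube ($3$-cell) over $V$ is an $8$-element subset of $V$ endowed with the graph structure of the $3$-dimensional cube $\{0,1\}^3$; it has six square faces. The cube condition for $g$ at a cube is the requirement that the product of the values of $g$ over the six square faces of the cube equals $1$. ''$g$ fails the cube condition with probability at most $p$'' means that for a uniformly random cube over $V$, the probability that this product is $-1$ is at most $p$. The function $[-1]$ on squares is defined, with respect to the linear order on $V$, by: $[-1]_c=+1$ if the vertices of $c$ can be read in increasing order going around the square (i.e. $c=(ijk\ell)$ with $i<j<k<\ell$), and $[-1]_c=-1$ otherwise. Products of functions are pointwise. *)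

(* Defs.v *)
From HB Require Import structures.
From mathcomp Require Import all_boot all_order all_algebra.
From mathcomp Require Import reals.

Set Implicit Arguments.
Unset Strict Implicit.
Unset Printing Implicit Defensive.

Import Order.TTheory GRing.Theory Num.Theory.

Local Open Scope ring_scope.

Definition mu2 : pred int := pred2 1 (-1).

(* A square or a cube (a vertex set carrying a graph structure without isolated
   vertices) is encoded by the edge set of its graph, each edge being a
   two-element set; the vertex set is the union of the edges. *)

Definition square_edges (V : finType) (i j k l : V) : {set {set V}} :=
  [set [set i; j]; [set j; k]; [set k; l]; [set l; i]].

Definition is_square (V : finType) (c : {set {set V}}) : bool :=
  [exists i : V, exists j : V, exists k : V, exists l : V,
    uniq [:: i; j; k; l] && (c == square_edges i j k l)].

Definition square (V : finType) : finType := {c : {set {set V}} | is_square c}.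

Lemma square_edgesP (V : finType) (i j k l : V) :
  uniq [:: i; j; k; l] -> is_square (square_edges i j k l).
Proof.
move=> u; apply/existsP; exists i; apply/existsP; exists j.
by apply/existsP; exists k; apply/existsP; exists l; rewrite u eqxx.
Qed.

(* The square (ijkl). *)
Definition sq (V : finType) (i j k l : V) (u : uniq [:: i; j; k; l]) :
  square V := exist _ (square_edges i j k l) (square_edgesP u).

(* The vertex set {0,1}^3 of the standard cube. *)
Definition Q3 : finType := {ffun 'I_3 -> bool}.

Definition Q3_adj (x y : Q3) : bool := #|[set a | x a != y a]| == 1%N.

Definition cube_edges (V : finType) (phi : {ffun Q3 -> V}) : {set {set V}} :=
  [set [set phi e.1; phi e.2] | e : Q3 * Q3 & Q3_adj e.1 e.2].

(* The edges of the image under phi of the face {x | x a = b}. *)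
Definition face_edges (V : finType) (phi : {ffun Q3 -> V}) (a : 'I_3) (b : bool)
    : {set {set V}} :=
  [set [set phi e.1; phi e.2]
    | e : Q3 * Q3 & [&& Q3_adj e.1 e.2, e.1 a == b & e.2 a == b]].

Definition is_labelling (V : finType) (E : {set {set V}}) (phi : {ffun Q3 -> V})
    : bool :=
  injectiveb phi && (E == cube_edges phi).

Definition is_cube (V : finType) (E : {set {set V}}) : bool :=
  [exists phi : {ffun Q3 -> V}, is_labelling E phi].

Definition cube (V : finType) : finType := {E : {set {set V}} | is_cube E}.

(* Two labellings of the same cube differ by an automorphism of the graph
   {0,1}^3, and these permute the six faces: the set of faces of a cube can be
   read off from any of its labellings. *)
Definition is_face (V : finType) (q : cube V) (c : square V) : bool :=
  [exists phi : {ffun Q3 -> V}, exists a : 'I_3, exists b : bool,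
    is_labelling (val q) phi && (val c == face_edges phi a b)].

Definition face_product (V : finType) (g : square V -> int) (q : cube V) : int :=
  \prod_(c : square V | is_face q c) g c.

(* The probability of P for a uniformly random element of T; it is 0 when T is
   empty. *)
Definition Pr (R : realType) (T : finType) (P : pred T) : R :=
  #|P|%:R / #|T|%:R.

Definition fails_cube_condition_at_most (R : realType) (V : finType)
    (g : square V -> int) (p : R) : Prop :=
  Pr R (fun q : cube V => face_product g q == -1) <= p.

(* The function [-1]. *)
Definition minus_one (d : Order.disp_t) (V : finOrderType d) (c : square V)
    : int :=
  if [exists i : V, exists j : V, exists k : V, exists l : V,
       [&& (i < j)%O, (j < k)%O, (k < l)%O & val c == square_edges i j k l]]
  then 1 else -1.

(* Main.v *)
Require Import Defs.
From mathcomp Require Import all_boot all_order all_algebra all_fingroup.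
From mathcomp Require Import reals ring.

(* Write h = [g = -1], with values in F_2. For a theta graph with poles a, b and
   middle vertices x, y, z let theta = h(axby) + h(aybz) + h(axbz), and for four
   vertices let kappa be the sum of h over the three squares they carry. Comparing
   two cubes that differ in a single vertex shows that, on a set of at least nine
   vertices on which all cube conditions hold, theta is a constant. The sign eps
   contributes (1, 1) to (theta, kappa) and [-1] contributes (1, 0), so after
   multiplication by suitable powers of both one may assume theta = 0 and
   kappa = 0; then h is a coboundary, as one sees by adding vertices one at a
   time, and its primitive is given by an explicit formula in h and three
   reference vertices.
   In general fix the reference vertices a, b, c, e, x, let eps, the power of [-1]
   and f be given by these formulas, and move the reference by a random
   permutation of V. A square can only be bad if some cube condition fails on the
   at most thirteen vertices of the square and of nine vertices containing the
   reference, and each of these boundedly many cubes is uniformly distributed.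
   Averaging over the permutation yields a reference with few bad squares. *)

Set Implicit Arguments.
Unset Strict Implicit.
Unset Printing Implicit Defensive.

Import Order.TTheory GRing.Theory Num.Theory.
Local Open Scope ring_scope.

(** * Theta graphs and cubes *)

Ltac split_uniq :=
  rewrite /= ?inE ?negb_or ?andbT -?andbA => *;
  repeat match goal with
  | H : is_true (_ && _) |- _ => let H1 := fresh in let H2 := fresh in
      case/andP: H => H1 H2
  end.
Ltac solve_uniq :=
  rewrite /= ?inE ?negb_or ?andbT -?andbA;
  repeat (apply/andP; split);
  match goal with
  | H : is_true (?a != ?b) |- is_true (?a != ?b) => exact: H
  | H : is_true (?b != ?a) |- is_true (?a != ?b) => rewrite eq_sym; exact: H
  | _ => done
  end.

Section Theta.
Variables (T : finType) (h : T -> T -> T -> T -> bool).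
Hypothesis rot : forall i j k l, h i j k l = h j k l i.
Hypothesis rev : forall i j k l, h i j k l = h l k j i.

Definition theta a b x y z := h a x b y (+) h a y b z (+) h a x b z.

Lemma exists_fresh (s : seq T) : (size s < #|T|)%N -> exists x, x \notin s.
Proof.
move=> ss; have /card_gt0P[x xs] : (0 < #|[predC s]|)%N.
  by rewrite -(ltn_add2l #|s|) addn0 cardC (leq_ltn_trans (card_size s)).
by exists x.
Qed.

(** The neighbours of the origin [o] are [p], [r], [q], and those of its antipode [v] are [x], [y],
    [z]. The faces come in opposite pairs, one pair per coordinate, and are read as in
    [face_productE], where the two sums agree by computation. *)
Definition cube_sum (P : bool -> bool -> bool -> T) :=
  let: (o, p) := (P false false false, P false false true) in
  let: (r, x) := (P false true false, P false true true) in
  let: (q, y) := (P true false false, P true false true) in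
  let: (z, v) := (P true true false, P true true true) in
  h o p x r (+) h q y v z (+) h o p y q (+) h r x v z (+) h o r z q (+) h p x v y.

Definition octuple (o p r x q y z v : T) (b0 b1 b2 : bool) :=
  if b0 then if b1 then if b2 then v else z else if b2 then y else q
  else if b1 then if b2 then x else r else if b2 then p else o.

Definition cube_closed := forall o p r x q y z v, uniq [:: o; p; r; x; q; y; z; v] ->
  cube_sum (octuple o p r x q y z v) = false.

(** The seven nontrivial symmetries of a square form one bundle of rewrite rules: instantiated at a
    chosen reading, it turns every other reading into that one. *)
Lemma dihedral i j k l : (h j k l i = h i j k l) * (h k l i j = h i j k l) * 
 (h l i j k = h i j k l) * (h l k j i = h i j k l) * (h k j i l = h i j k l) *
   (h j i l k = h i j k l) *
 (h i l k j = h i j k l).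
Proof. by do ![split]; rewrite ?(rev l k j i) ?(rev i l k j) ?(rev k j i l) ?(rev j i l k)
  ?(rot i j k l) ?(rot j k l i) ?(rot k l i j). Qed.

Hypothesis cubeP : cube_closed.

(* The sum of the cube conditions of two cubes that share all vertices but one
   (v, respectively w); the three faces away from that vertex cancel. *)
Lemma theta_relation o p q r x y z v w : uniq [:: o; p; q; r; x; y; z; v; w] ->
  theta x y v w p (+) theta y z v w q (+) theta z x v w r (+) theta v w x y z = false.
Proof.
split_uniq.
have := @cubeP o p r x q y z v; have := @cubeP o p r x q y z w.
rewrite /cube_sum /= => Cw Cv.
have {}Cw := Cw ltac:(solve_uniq); have {}Cv := Cv ltac:(solve_uniq).
move: Cw Cv; rewrite /theta (dihedral x v y p) (dihedral x w y p) (dihedral y v z q)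
  (dihedral y w z q).
rewrite (dihedral z v x r) (dihedral z w x r) (dihedral v x w y) (dihedral v y w z)
  (dihedral v x w z).
move: (h x v y p) (h x w y p) (h y v z q) (h y w z q) (h z v x r) (h z w x r)
  (h v x w y) (h v y w z) (h v x w z) (h o p x r) (h o p y q) (h o r z q).
by do 12!case.
Qed.

Hypothesis card_T : (9 <= #|T|)%N.

(** The vertex [o] does not occur in the conclusion of [theta_relation]. Two instances in which [z]
    and [z'] exchange the places of [o] and [p] therefore share their other three terms. *)
Lemma theta_replace a b x y z z' : uniq [:: a; b; x; y; z] -> uniq [:: a; b; x; y; z'] ->
  theta a b x y z = theta a b x y z'.
Proof.
move=> U U'; case: (eqVneq z z') => [->//|zz'].
have [c fc] := exists_fresh (s := [:: a; b; x; y; z; z']) (leq_trans (isT : 6 < 9)%N card_T).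
have [q fq] := exists_fresh (s := [:: a; b; x; y; z; z'; c]) (leq_trans (isT : 7 < 9)%N card_T).
have [r fr] := exists_fresh (s := [:: a; b; x; y; z; z'; c; q])
  (leq_trans (isT : 8 < 9)%N card_T).
move: U U' fc fq fr; split_uniq.
have := @theta_relation z' z q r a b c x y; have := @theta_relation z z' q r a b c x y.
move=> C' C; have {}C := C ltac:(solve_uniq); have {}C' := C' ltac:(solve_uniq).
move: C C'; move: (theta _ _ _ _ q) (theta _ _ _ _ r) (theta x y _ _ _) => A B D.
by move: (theta _ _ _ _ z) (theta _ _ _ _ z') A B D; do 5!case.
Qed.

Lemma thetaS a b x y z : (theta a b x z y = theta a b x y z) *
  (theta a b y x z = theta a b x y z) *
  (theta a b y z x = theta a b x y z) * (theta a b z x y = theta a b x y z) *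
    (theta a b z y x = theta a b x y z).
Proof.
by rewrite /theta (dihedral a x b y) (dihedral a x b z) (dihedral a y b z); do 3!case:
  (h _ _ _ _).
Qed.

Lemma theta_replace2 a b x y x' y' z : uniq [:: a; b; x; y; z] -> uniq [:: a; b; x'; y'; z] ->
  theta a b x y z = theta a b x' y' z.
Proof.
(* If [x'] is already the middle vertex [y], replacing [x] by [x'] would repeat a vertex; in that
   case only [x] has to be replaced, by [y']. *)
case: (eqVneq x' y) => [->|x'y] U U'.
  rewrite (thetaS a b y z x) (thetaS a b y z y').
  by apply: theta_replace; move: U U'; split_uniq; solve_uniq.
rewrite (thetaS a b y z x) (@theta_replace a b y z x x'); last 2 first.
- by move: U U'; split_uniq; solve_uniq.
- by move: U U'; split_uniq; solve_uniq.
rewrite (thetaS a b z x' y) (thetaS a b z x' y') (thetaS a b x' z y) (thetaS a b x' z y').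
by apply: theta_replace; move: U U'; split_uniq; solve_uniq.
Qed.

Lemma theta_triple a b x y z x' y' z' : uniq [:: a; b; x; y; z] -> uniq [:: a; b; x'; y'; z'] ->
  theta a b x y z = theta a b x' y' z'.
Proof.
move=> U U'; have [E|N] := boolP (z' \in [:: x; y]).
  move: E; rewrite !inE => /orP[] /eqP E; subst z'.
    rewrite (thetaS a b y z x); apply: theta_replace2 => //.
    by move: U; split_uniq; solve_uniq.
  rewrite (thetaS a b x z y); apply: theta_replace2 => //.
  by move: U; split_uniq; solve_uniq.
have U2 : uniq [:: a; b; x; y; z'] by move: U U' N; split_uniq; solve_uniq.
by rewrite (theta_replace U U2); apply: theta_replace2.
Qed.

(** By [theta_triple] only the poles matter. For fixed [u], [v], [w], [theta_relation] writes the
    value at poles [c], [d] as the sum of the values at the pole pairs [uv], [vw], [wu], which does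
    not depend on [c] and [d]. *)
Lemma theta_const a b x y z a' b' x' y' z' : uniq [:: a; b; x; y; z] ->
  uniq [:: a'; b'; x'; y'; z'] ->
  theta a b x y z = theta a' b' x' y' z'.
Proof.
move=> U U'.
have [u fu] := exists_fresh (s := [:: a; b; a'; b']) (leq_trans (isT : 4 < 9)%N card_T).
have [v fv] := exists_fresh (s := [:: a; b; a'; b'; u]) (leq_trans (isT : 5 < 9)%N card_T).
have [w fw] := exists_fresh (s := [:: a; b; a'; b'; u; v]) (leq_trans (isT : 6 < 9)%N card_T).
have D : uniq [:: a; b; u; v; w] by move: U fu fv fw; split_uniq; solve_uniq.
have D' : uniq [:: a'; b'; u; v; w] by move: U' fu fv fw; split_uniq; solve_uniq.
rewrite (theta_triple U D) (theta_triple U' D').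
suff P c d : uniq [:: c; d; u; v; w] ->
    theta c d u v w = theta u v c d w (+) theta v w c d u (+) theta w u c d v.
  by rewrite !P // (@theta_triple u v a b w a' b' w) ?(@theta_triple v w a b u a' b' u)
    ?(@theta_triple w u a b v a' b' v) //; move: D D'; split_uniq; solve_uniq.
move=> {}D.
have [q fq] := exists_fresh (s := [:: u; v; w; c; d]) (leq_trans (isT : 5 < 9)%N card_T).
have [r fr] := exists_fresh (s := [:: u; v; w; c; d; q]) (leq_trans (isT : 6 < 9)%N card_T).
have [s fs] := exists_fresh (s := [:: u; v; w; c; d; q; r]) (leq_trans (isT : 7 < 9)%N card_T).
have [o fo] := exists_fresh (s := [:: u; v; w; c; d; q; r; s]) (leq_trans (isT : 8 < 9)%N card_T).
have := @theta_relation o q r s u v w c d.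
rewrite (@theta_triple u v c d q c d w) ?(@theta_triple v w c d r c d u)
  ?(@theta_triple w u c d s c d v);
  try by move: D fq fr fs fo; split_uniq; solve_uniq.
move=> C; have {}C := C ltac:(by move: D fq fr fs fo; split_uniq; solve_uniq).
by move: C; do 4!case: (theta _ _ _ _ _).
Qed.
End Theta.

(** * Primitives of functions on squares *)

Section Primitive.
Variables (T : finType) (h : T -> T -> T -> T -> bool).
Hypothesis rot : forall i j k l, h i j k l = h j k l i.
Hypothesis rev : forall i j k l, h i j k l = h l k j i.
Hypothesis theta0 : forall a b x y z, uniq [:: a; b; x; y; z] -> theta h a b x y z = false.

Definition primitive_on (A : {set T}) (f : T -> T -> bool) :=
  (forall i j, f i j = f j i) /\
  (forall i j k l, uniq [:: i; j; k; l] -> i \in A -> j \in A -> k \in A -> l \in A ->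
     h i j k l = f i j (+) f j k (+) f k l (+) f l i).

(** Adding a constant to all edges at the new vertex [v] changes no square, so the edge to [y0] may
    get the value 0. The square [(v y0 z y)] then forces the value [psi y], and theta at poles [y0],
    [y] shows that [z] does not matter. The last hypothesis serves the squares in which [y0] is
    opposite to [v]: either [A] has a fourth vertex to compare with, or kappa vanishes. *)
Lemma primitive_extend (A : {set T}) f v y0 :
  primitive_on A f -> (2 < #|A|)%N -> v \notin A -> y0 \in A ->
  (forall x y, uniq [:: x; y; y0] -> x \in A -> y \in A ->
     (exists2 z, z \in A & z \notin [:: x; y; y0]) \/
     h v x y0 y (+) h v y0 x y (+) h v y0 y x = false) ->
  exists f', primitive_on (v |: A) f'.
Proof.
move=> [fC fA] cA vA y0A K.
pose psi y := if y == y0 then false else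
  if [pick z in A :\ y :\ y0] is Some z then h v y0 z y (+) f y0 z (+) f z y else false.
have neqv x : x \in A -> v != x by apply: contraTneq => <-.
have psiE y z : y \in A -> z \in A -> uniq [:: y0; y; z] ->
    psi y = h v y0 z y (+) f y0 z (+) f z y.
  move=> yA zA U; rewrite /psi ifN_eqC; last by move: U; split_uniq; solve_uniq.
  case: pickP => [w|/(_ z)/negbT/negP[]]; last first.
    by move: U; rewrite !inE zA andbT; split_uniq; solve_uniq.
  rewrite !inE => /and3P[wy0 wy wA].
  case: (eqVneq w z) => [->//|wz].
  have Uv : uniq [:: y0; y; v; w; z].
    by have := neqv _ y0A; have := neqv _ yA; have := neqv _ zA; have := neqv _ wA; move: U;
      split_uniq; solve_uniq.
  have := theta0 Uv; rewrite /theta (fA y0 w y z) //; last by move: Uv; split_uniq; solve_uniq.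
  rewrite (dihedral rot rev v y0 w y) (dihedral rot rev v y0 z y) (fC w y) (fC z y) (fC z y0).
  move: (h v y0 w y) (h v y0 z y) (f y0 w) (f y w) (f y z) (f y0 z).
  by do 6!case.
have psi0 : psi y0 = false by rewrite /psi eqxx.
have hv x z y : uniq [:: x; z; y] -> x \in A -> z \in A -> y \in A ->
    h v x z y = psi x (+) f x z (+) f z y (+) psi y.
  have base y' z' : uniq [:: y0; y'; z'] -> y' \in A -> z' \in A ->
      h v y0 z' y' = f y0 z' (+) f z' y' (+) psi y'.
    by move=> U yA zA; rewrite (psiE y' z') //; move: (h _ _ _ _) (f y0 z') (f z' y'); do 3!case.
  (* Theta with poles [v], [z'] and middle vertices [x'], [y'], [y0] reduces these squares to those
     in which [y0] is a neighbour of [v]. *)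
  have off_y0 x' z' y' : uniq [:: x'; z'; y'] -> x' \in A -> z' \in A -> y' \in A -> z' != y0 ->
      h v x' z' y' = psi x' (+) f x' z' (+) f z' y' (+) psi y'.
    move=> U xA zA yA z0; case: (eqVneq x' y0) => [x0|x0].
      by rewrite x0 psi0; apply: base; rewrite // -x0; move: U; split_uniq; solve_uniq.
    have E w : w != y0 -> w != z' -> w \in A -> h v w z' y0 = f y0 z' (+) f z' w (+) psi w.
      move=> w0 wz wA; rewrite (dihedral rot rev v y0 z' w); apply: base => //.
      by move: z0; split_uniq; solve_uniq.
    case: (eqVneq y' y0) => [y0E|y0N].
      rewrite y0E psi0 E //; last by move: U; split_uniq; solve_uniq.
      by rewrite (fC z' y0) (fC z' x'); move: (f _ _) (f x' z') (psi x'); do 3!case.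
    have Uv : uniq [:: v; z'; x'; y'; y0].
      by have := neqv _ y0A; have := neqv _ yA; have := neqv _ zA; have := neqv _ xA; move: U;
        split_uniq; solve_uniq.
    have := theta0 Uv; rewrite /theta !E //; try by move: U; split_uniq; solve_uniq.
    rewrite (fC z' x').
    by move: (h v _ _ _) (f x' _) (f z' _) (f y0 _) (psi x') (psi y'); do 6!case.
  move=> U xA zA yA; case: (eqVneq z y0) => [zE|]; last exact: off_y0.
  move: U; rewrite zE => U.
  have U' : uniq [:: x; y; y0] by move: U; split_uniq; solve_uniq.
  (* Theta with poles [x], [y] and middle vertices [v], [y0], [z'] moves the vertex opposite to [v]
     from [y0] to [z']. *)
  case: (K x y U' xA yA) => [[z' z'A z'N]|].
    have Uv : uniq [:: x; y; v; y0; z'].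
      by have := neqv _ y0A; have := neqv _ yA; have := neqv _ z'A; have := neqv _ xA; move:
        U z'N; split_uniq; solve_uniq.
    have := theta0 Uv; rewrite /theta (fA x y0 y z') //; last by move: Uv; split_uniq; solve_uniq.
    rewrite (dihedral rot rev v x y0 y) (dihedral rot rev v x z' y) (off_y0 x z' y) //;
      try by move: Uv; split_uniq; solve_uniq.
    rewrite (fC y z') (fC z' x).
    move: (h v _ _ _) (f x y0) (f y0 y) (f x z') (f z' y) (psi x) (psi y).
    by do 7!case.
  rewrite base ?(base x y) //; try by move: U'; split_uniq; solve_uniq.
  rewrite (fC y x) (fC y0 x).
  move: (h v _ _ _) (f x y0) (f y0 y) (f x y) (psi x) (psi y).
  by do 6!case.
pose f' i j := if i == v then psi j else if j == v then psi i else f i j.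
have f'C i j : f' i j = f' j i.
  by rewrite /f'; case: (eqVneq i v) => [Ei|_]; case: (eqVneq j v) => [Ej|_] //; rewrite Ei Ej.
have f'v j : f' v j = psi j by rewrite /f' eqxx.
have f'A i j : i \in A -> j \in A -> f' i j = f i j.
  by move=> iA jA; rewrite /f' !ifN_eqC ?neqv.
have at_v x z y : uniq [:: v; x; z; y] -> x \in v |: A -> z \in v |: A -> y \in v |: A ->
    h v x z y = f' v x (+) f' x z (+) f' z y (+) f' y v.
  move=> U; have : [&& x != v, z != v & y != v] by move: U; split_uniq; solve_uniq.
  case/and3P=> xv zv yv; rewrite !inE (negPf xv) (negPf zv) (negPf yv) /= => xA zA yA.
  rewrite (f'C y) !f'v !f'A // hv //.
  by move: U; split_uniq; solve_uniq.
exists f'; split=> // i j k l U iA jA kA lA.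
case: (eqVneq i v) => [E|iv]; first by subst i; apply: at_v.
case: (eqVneq j v) => [E|jv].
  subst j; rewrite rot at_v //; last by move: U; split_uniq; solve_uniq.
  by move: (f' v _) (f' k _) (f' l _) (f' i _); do 4!case.
case: (eqVneq k v) => [E|kv].
  subst k; rewrite rot rot at_v //; last by move: U; split_uniq; solve_uniq.
  by move: (f' v _) (f' j _) (f' l _) (f' i _); do 4!case.
case: (eqVneq l v) => [E|lv].
  subst l; rewrite -rot at_v //; last by move: U; split_uniq; solve_uniq.
  by move: (f' v _) (f' j _) (f' k _) (f' i _); do 4!case.
move: iA jA kA lA; rewrite !inE (negPf iv) (negPf jv) (negPf kv) (negPf lv) /= => iA jA kA lA.
by rewrite !f'A // fA.
Qed.

Lemma uniq_leq_card (s : seq T) (A : {set T}) : uniq s -> {subset s <= A} -> (size s <= #|A|)%N.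
Proof. by move=> /card_uniqP <- sub; apply: subset_leq_card; apply/subsetP. Qed.

(** Three vertices carry no square, so 0 is a primitive on [a], [b], [c]. The vertex [d] is added by
    means of the kappa condition, every later vertex by means of a fourth vertex. *)
Lemma primitive_exists a b c d : uniq [:: a; b; c; d] ->
  h a b c d (+) h a b d c (+) h a c b d = false ->
  exists f, primitive_on setT f.
Proof.
move=> U K.
have [f1 Pf1] : exists f, primitive_on (d |: [set a; b; c]) f.
  apply: (@primitive_extend _ (fun _ _ => false) d a); rewrite ?inE ?eqxx //.
  - split=> // i j k l V; rewrite !inE.
    by do 4![case/orP=> [/orP[]|] /eqP ?]; subst; move: V; rewrite /= !inE ?eqxx ?orbT ?andbF.
  - apply: (uniq_leq_card (s := [:: a; b; c])); first by move: U; split_uniq; solve_uniq.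
    by move=> x; rewrite !inE orbA.
  - by move: U; split_uniq; solve_uniq.
  move=> x y V; rewrite !inE => xA yA; right; move: V K.
  case/orP: xA => [/orP[]|] /eqP ?; case/orP: yA => [/orP[]|] /eqP ?; subst x y;
    rewrite /= !inE ?eqxx ?orbT ?andbF //= => _.
  - rewrite (dihedral rot rev a b d c) (dihedral rot rev a b c d) (dihedral rot rev a c b d).
    by do 3!case: (h _ _ _ _).
  - rewrite (dihedral rot rev a b d c) (dihedral rot rev a b c d) (dihedral rot rev a c b d).
  by do 3!case: (h _ _ _ _).
have step : forall s : seq T, exists f, primitive_on ([set x in s] :|: (d |: [set a; b; c])) f.
  elim=> [|v s [f Pf]]; first by exists f1; rewrite set_nil set0U.
  rewrite set_cons -setUA.
  have [vA|vA] := boolP (v \in [set x in s] :|: (d |: [set a; b; c])).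
    by exists f; rewrite (setUidPr _) // sub1set.
  apply: (@primitive_extend _ f v a Pf).
  - apply: (uniq_leq_card (s := [:: a; b; c])); first by move: U; split_uniq; solve_uniq.
    by move=> x; rewrite !inE => /or3P[] ->; rewrite ?orbT.
  - exact: vA.
  - by rewrite !inE eqxx !orbT.
  move=> x y V xA yA; left.
  (* The four vertices [a], [b], [c], [d] do not fit among [x], [y], [a]; this yields the fourth
     vertex. *)
  have /allPn[z zs zN] : ~~ all (mem [:: x; y; a]) [:: b; c; d].
    apply/negP => /allP sub; suff /(uniq_leq_size U) :
      {subset [:: a; b; c; d] <= [:: x; y; a]} by [].
    by move=> z; rewrite inE => /predU1P[->|/sub //]; rewrite !inE eqxx !orbT.
  exists z => //; move: zs; rewrite !inE => /or3P[] ->; rewrite ?orbT //.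
have [f Pf] := step (enum T); exists f.
by have <- : [set x in enum T] :|: (d |: [set a; b; c]) = setT by apply/setP=> x;
  rewrite !inE mem_enum.
Qed.
End Primitive.

(** * Explicit primitives relative to reference vertices *)

Definition kappa (T : Type) (h : T -> T -> T -> T -> bool) a b c d :=
  h a b c d (+) h a b d c (+) h a c b d.

(* The primitive f of h with f a j = 0 for all j and f b c = 0, read off from the
   squares (b j a c) and (i j a b); here h is 0 on degenerate quadruples. *)
Definition ref_primitive (T : eqType) (h : T -> T -> T -> T -> bool) a b c i j :=
  if (i == a) || (j == a) then false
  else if i == b then h b j a c
  else if j == b then h b i a c
  else h i j a b (+) h b i a c.

(** Every primitive [f] becomes the explicit one after a change of gauge: around a square each [x i]
    is counted twice and [t] four times, so the coboundary is unchanged. The value [t] at [a] kills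
    the edges at [a], and [t], the sum of [f] around the triangle [abc], kills the edge [bc]. *)
Lemma ref_primitiveE (T : finType) (h : T -> T -> T -> T -> bool) (f : T -> T -> bool) a b c i j :
  (forall i j k l, ~~ uniq [:: i; j; k; l] -> h i j k l = false) ->
  primitive_on h setT f -> uniq [:: a; b; c] -> i != j ->
  let t := f a b (+) f b c (+) f c a in
  let x i := if i == a then t else f a i in
  ref_primitive h a b c i j = f i j (+) x i (+) x j (+) t.
Proof.
move=> deg [fC fA] U ij t x.
have {}fA i' j' k l : uniq [:: i'; j'; k; l] ->
  h i' j' k l = f i' j' (+) f j' k (+) f k l (+) f l i'.
  by move=> V; apply: fA; rewrite ?in_setT.
rewrite /ref_primitive /x.
case: (eqVneq i a) => [Ei|ia] /=.
  by rewrite Ei in ij *; rewrite eq_sym (negPf ij); move: (f a j) (t); do 2!case.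
case: (eqVneq j a) => [Ej|ja] /=; first by rewrite Ej (fC i a); move: (f a i) (t); do 2!case.
have B k : k != a -> k != b -> h b k a c = f b k (+) f a k (+) f a b (+) t.
  (* At [k = c] the quadruple [b c a c] is degenerate, and the convention that [h] is 0 there gives
     the required value 0 on the edge [bc]. *)
  move=> ka kb; rewrite /t; case: (eqVneq k c) => [->|kc].
    rewrite deg ?(fC c a); first by move: (f a b) (f b c) (f a c); do 3!case.
    by rewrite /= !inE eqxx ?orbT ?andbF.
  rewrite fA; last by move: U ka kb kc; split_uniq; solve_uniq.
  by rewrite (fC k a) (fC c a) (fC c b); move: (f a b) (f b c) (f a c) (f b k) (f a k); do 5!case.
case: (eqVneq i b) => [Ei|ib].
  rewrite Ei in ij *; rewrite B //; last by rewrite eq_sym.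
  by move: (f b j) (f a j) (f a b) (t); do 4!case.
case: (eqVneq j b) => [Ej|jb].
  by rewrite Ej B // (fC i b); move: (f b i) (f a i) (f a b) (t); do 4!case.
rewrite B // fA; last by move: U ij ia ib ja jb; split_uniq; solve_uniq.
by rewrite (fC j a) (fC b i); move: (f i j) (f a j) (f a b) (f i b) (f a i) (t); do 6!case.
Qed.

Lemma ref_primitive_square (T : finType) (h : T -> T -> T -> T -> bool) a b c d e :
  (forall i j k l, h i j k l = h j k l i) -> (forall i j k l, h i j k l = h l k j i) ->
  (forall i j k l, ~~ uniq [:: i; j; k; l] -> h i j k l = false) ->
  (forall a b x y z, uniq [:: a; b; x; y; z] -> theta h a b x y z = false) ->
  uniq [:: a; b; c; d; e] -> kappa h a b c d = false ->
  let f := ref_primitive h a b c in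
  (forall i j, i != j -> f i j = f j i) /\
  (forall i j k l, uniq [:: i; j; k; l] -> h i j k l = f i j (+) f j k (+) f k l (+) f l i).
Proof.
move=> rot rev deg th0 U K.
have [f Pf] := @primitive_exists _ h rot rev th0 a b c d
  ltac:(by move: U; split_uniq; solve_uniq) K.
have E i' j' := @ref_primitiveE _ h f a b c i' j' deg Pf
  ltac:(by move: U; split_uniq; solve_uniq).
split=> [i j ij|i j k l V].
  rewrite !E // 1?eq_sym // (Pf.1 i j); congr (_ (+) _).
  by rewrite -!addbA; congr (_ (+) _); rewrite addbC.
rewrite !E; try by move: V; split_uniq; solve_uniq.
rewrite (Pf.2 i j k l) ?in_setT //.
move: (f i j) (f j k) (f k l) (f l i) (f a b (+) f b c (+) f c a) => ij jk kl li t.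
by case: t; move: (if _ == _ then _ else _) (if _ == _ then _ else _) (if _ == _ then _ else _)
  (if _ == _ then _ else _); move: ij jk kl li; do 8!case.
Qed.

(** Additive form of multiplying by a sign and a power of [-1]. The factor [uniq] restores the value
    0 on degenerate quadruples, on which [ref_primitive] relies. *)
Definition normalized (T : eqType) (h m : T -> T -> T -> T -> bool) (k b : bool) i j p q :=
  uniq [:: i; j; p; q] && (h i j p q (+) k (+) (b && m i j p q)).

(** Theta and kappa are sums of three squares, so the constant [k] adds [k] to both, while [s] times
    [m] adds [s] to theta and 0 to kappa. The chosen [k] and [s] make both vanish at the reference;
    [theta_const] carries the vanishing of theta to all theta graphs. *)
Lemma cube_closed_primitive (T : finType) (h m : T -> T -> T -> T -> bool) a b c d e :
  (forall i j k l, h i j k l = h j k l i) -> (forall i j k l, h i j k l = h l k j i) ->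
  (forall i j k l, m i j k l = m j k l i) -> (forall i j k l, m i j k l = m l k j i) ->
  (forall a b x y z, uniq [:: a; b; x; y; z] -> theta m a b x y z = true) ->
  (forall a b c d, uniq [:: a; b; c; d] -> kappa m a b c d = false) ->
  (9 <= #|T|)%N -> cube_closed h ->
  uniq [:: a; b; c; d; e] ->
  let k := kappa h a b c d in
  let s := k (+) theta h a b c d e in
  let f := ref_primitive (normalized h m k s) a b c in
  (forall i j, i != j -> f i j = f j i) /\
  (forall i j p q, uniq [:: i; j; p; q] ->
     h i j p q (+) (s && m i j p q) = k (+) f i j (+) f j p (+) f p q (+) f q i).
Proof.
move=> hrot hrev mrot mrev mth mka cT hcube U k s f.
set h2 := normalized h m k s.
have h2E i' j' p' q' : uniq [:: i'; j'; p'; q'] ->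
  h2 i' j' p' q' = h i' j' p' q' (+) k (+) (s && m i' j' p' q').
  by rewrite /h2 /normalized => ->.
suff [fC fE] : (forall i j, i != j -> f i j = f j i) /\
    (forall i j p q, uniq [:: i; j; p; q] -> h2 i j p q = f i j (+) f j p (+) f p q (+) f q i).
  split=> // i j p q V; move: (fE i j p q V).
  rewrite h2E //; move: (h i j p q) (s && _) (f i j) (f j p) (f p q) (f q i) (k).
  by do 7!case.
apply: (@ref_primitive_square _ h2 a b c d e) => //.
- move=> i' j' p' q'; rewrite /h2 /normalized (hrot i' j') (mrot i' j'); congr (_ && _).
  by apply/idP/idP; split_uniq; solve_uniq.
- move=> i' j' p' q'; rewrite /h2 /normalized (hrev i' j') (mrev i' j'); congr (_ && _).
  by apply/idP/idP; split_uniq; solve_uniq.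
- by move=> i' j' p' q'; rewrite /h2 /normalized => /negPf->.
- move=> a' b' x y z W; have := mth _ _ _ _ _ W.
  have := @theta_const _ h hrot hrev hcube cT a b c d e a' b' x y z U W.
  rewrite /theta !h2E; try by move: W; split_uniq; solve_uniq.
  rewrite /s /theta => ->; move: (h a' _ _ _) (h a' y _ _) (h a' x b' z) (m a' x b' y)
    (m a' y _ _) (m a' x b' z) (k).
  by do 7!case.
rewrite /kappa !h2E; try by move: U; split_uniq; solve_uniq.
have := mka a b c d ltac:(by move: U; split_uniq; solve_uniq).
rewrite /k /kappa; move: (s) (h a b c d) (h a b d c) (h a c b d) (m a b c d) (m a b d c)
  (m a c b d).
by do 7!case.
Qed.

(** * Squares as edge sets and the function [-1] *)

Section Edges.
Variable V : finType.

Lemma set2_eqP (x y a b : V) :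
  [set x; y] = [set a; b] -> (x = a /\ y = b) \/ (x = b /\ y = a).
Proof.
move/setP=> E; have := E x; have := E y; have := E a; have := E b.
rewrite !inE !eqxx ?orbT /= => Eb Ea /esym/orP[] /eqP y_ /esym/orP[] /eqP x_; subst x y;
  rewrite ?orbb in Ea Eb; auto.
  by move/eqP: Eb => ->; left.
by move/eqP: Ea => ->; left.
Qed.

Lemma square_edges_rot (i j k l : V) : square_edges i j k l = square_edges j k l i.
Proof. by apply/setP=> e; rewrite !inE -!orbA [LHS]orbC -!orbA. Qed.

Lemma square_edges_rev (i j k l : V) : square_edges i j k l = square_edges l k j i.
Proof.
rewrite /square_edges (setUC [set l] [set k]) (setUC [set k] [set j]) (setUC [set j] [set i]).
rewrite (setUC [set i] [set l]); apply/setP=> e; rewrite !inE.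
by do 4!case: (e == _).
Qed.

Lemma mem_square_edges (i j k l x y : V) : [set x; y] \in square_edges i j k l ->
  (x, y) \in [:: (i, j); (j, k); (k, l); (l, i); (j, i); (k, j); (l, k); (i, l)].
Proof.
rewrite !in_setU !in_set1 => H.
have {H} : [\/ [set x; y] = [set i; j], [set x; y] = [set j; k],
  [set x; y] = [set k; l] | [set x; y] = [set l; i]].
  by move: H => /orP[/orP[/orP[]|]|] /eqP ->; constructor.
by case=> /set2_eqP [] [-> ->]; rewrite !inE eqxx ?orbT.
Qed.

(** The edge [i'j'] is one of the eight oriented edges of the first cycle. After that every vertex
    is forced, because turning back would repeat a vertex. *)
Lemma square_edges_inj (i j k l i' j' k' l' : V) :
  uniq [:: i; j; k; l] -> uniq [:: i'; j'; k'; l'] ->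
  square_edges i j k l = square_edges i' j' k' l' ->
  (i', j', k', l') \in [:: (i, j, k, l); (j, k, l, i); (k, l, i, j); (l, i, j, k);
                         (l, k, j, i); (k, j, i, l); (j, i, l, k); (i, l, k, j)].
Proof.
move=> U U' E.
have := @mem_square_edges i j k l i' j'; have := @mem_square_edges i j k l j' k'.
have := @mem_square_edges i j k l k' l'.
rewrite E /square_edges !inE !eqxx ?orbT => /(_ isT) kl /(_ isT) jk /(_ isT) ij.
move: U U'; rewrite /= !inE !negb_or -!andbA !andbT.
have neq (x y : V) : (x == y) = false -> (y == x) = false by rewrite eq_sym.
case/and5P=> /negPf i1 /negPf i2 /negPf i3 /negPf i4 /andP[/negPf i5 /negPf i6].
have N := (neq _ _ i1, neq _ _ i2, neq _ _ i3, neq _ _ i4, neq _ _ i5, neq _ _ i6).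
case/and5P=> _ /negPf n1 _ _ /andP[/negPf n2 _].
do 7?[case/orP: ij => [/eqP[? ?]|ij]]; last (case/eqP: ij => ? ?); subst i' j'; move: jk;
  rewrite !xpair_eqE ?eqxx ?i1 ?i2 ?i3 ?i4 ?i5 ?i6 ?N /= ?orbF.
all: case/orP=> /eqP ?; subst k'; first [by rewrite eqxx in n1 | move: kl].
all: rewrite !xpair_eqE ?eqxx ?i1 ?i2 ?i3 ?i4 ?i5 ?i6 ?N /= ?orbF.
all: case/orP=> /eqP ?; subst l'; first [by rewrite eqxx in n2 | by rewrite ?eqxx ?orbT].
Qed.
End Edges.

Section SquareValue.
Variables (V : finType) (g : square V -> int).

(** This is the additive form [h] of [g], as a function of four vertices with value 0 on degenerate
    quadruples. *)
Definition negative i j k l : bool :=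
  uniq [:: i; j; k; l] && (if insub (square_edges i j k l) is Some c then g c == -1 else false).

Lemma negativeE i j k l (u : uniq [:: i; j; k; l]) : negative i j k l = (g (sq u) == -1).
Proof.
rewrite /negative u; case: insubP => [c _ cE|]; last by rewrite square_edgesP.
by congr (g _ == _); apply: val_inj.
Qed.

Lemma negative_rot i j k l : negative i j k l = negative j k l i.
Proof.
rewrite /negative square_edges_rot; congr (_ && _).
by apply/idP/idP; split_uniq; solve_uniq.
Qed.

Lemma negative_rev i j k l : negative i j k l = negative l k j i.
Proof.
rewrite /negative square_edges_rev; congr (_ && _).
by apply/idP/idP; split_uniq; solve_uniq.
Qed.

Lemma squareP (c : square V) : exists i j k l (u : uniq [:: i; j; k; l]), c = sq u.
Proof.
case: c => E /[dup] /existsP[i /existsP[j /existsP[k /existsP[l /andP[u /eqP EE]]]]] sE.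
by exists i, j, k, l, u; apply: val_inj.
Qed.

End SquareValue.

Section MinusOne.
Variables (d : Order.disp_t) (V : finOrderType d).
Local Notation m := (negative (@minus_one d V)).

(** Going around a square one meets 1, 2 or 3 ascents. The monotone squares are those with 3
    ascents, or 1 when read backwards, so [-1] is the parity of the number of ascents. *)
Lemma negative_minus_one i j k l : uniq [:: i; j; k; l] ->
  m i j k l = ~~ ((i < j)%O (+) (j < k)%O (+) (k < l)%O (+) (l < i)%O).
Proof.
move=> u; rewrite (negativeE _ u) /minus_one.
set b := [exists i, _].
suff -> : b = (i < j)%O (+) (j < k)%O (+) (k < l)%O (+) (l < i)%O by case: ifP.
apply/idP/idP.
  case/existsP=> i' /existsP[j' /existsP[k' /existsP[l' /and4P[ij jk kl /eqP]]]].
  have ik := lt_trans ij jk; have jl := lt_trans jk kl; have il := lt_trans ik kl.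
  have U' : uniq [:: i'; j'; k'; l'].
    by rewrite /= !inE !negb_or !lt_eqF.
  move/(square_edges_inj u U'); rewrite !inE !xpair_eqE.
  by do 7?[case/orP=> [/andP[/andP[/andP[/eqP ? /eqP ?] /eqP ?] /eqP ?]|]];
    last (case/andP=> [/andP[/andP[/eqP ? /eqP ?] /eqP ?] /eqP ?]); subst i' j' k' l';
    rewrite ?ij ?jk ?kl ?il ?(lt_gtF ij) ?(lt_gtF jk) ?(lt_gtF kl) ?(lt_gtF il).
have W i' j' k' l' : square_edges i' j' k' l' = square_edges i j k l ->
    (i' < j')%O -> (j' < k')%O -> (k' < l')%O -> b.
  move=> E ij jk kl; apply/existsP; exists i'; apply/existsP; exists j'; apply/existsP; exists k'.
  by apply/existsP; exists l'; rewrite ij jk kl /= E.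
have r1 := square_edges_rot i j k l; have r2 := square_edges_rot j k l i.
have r3 := square_edges_rot k l i j; have r := square_edges_rev i j k l.
have s1 := square_edges_rot l k j i; have s2 := square_edges_rot k j i l.
have s3 := square_edges_rot j i l k.
have w1 := W i j k l erefl; have w2 := W j k l i (esym r1).
have w3 := W k l i j (esym (etrans r1 r2));
  have w4 := W l i j k (esym (etrans r1 (etrans r2 r3))).
have w5 := W l k j i (esym r); have w6 := W k j i l (esym (etrans r s1)).
have w7 := W j i l k (esym (etrans r (etrans s1 s2))).
have w8 := W i l k j (esym (etrans r (etrans s1 (etrans s2 s3)))).
move: (u); rewrite /= !inE !negb_or -!andbA !andbT.
case/and5P=> ij _ il jk /andP[_ kl].
case: (ltgtP i j) ij => // ij _; case: (ltgtP j k) jk => // jk _.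
all: case: (ltgtP k l) kl => // kl _; case: (ltgtP i l) il => // il _ //= _.
all: by [apply: w1|apply: w2|apply: w3|apply: w4|apply: w5|apply: w6|apply: w7|apply: w8].
Qed.

(** Each edge of the theta graph lies on two of the squares. Only the two edges at [y] are read in
    opposite directions; they contribute 1 each, and the three negations contribute 1 in total. *)
Lemma theta_minus_one a b x y z : uniq [:: a; b; x; y; z] -> theta m a b x y z = true.
Proof.
move=> U; rewrite /theta !negative_minus_one; try by move: U; split_uniq; solve_uniq.
have N (s t : V) : s != t -> (s < t)%O = ~~ (t < s)%O.
  by move=> st; rewrite -leNgt le_eqVlt (negPf st).
move: U; split_uniq; have -> := N b y ltac:(solve_uniq); have -> := N y a ltac:(solve_uniq).
by do 6!case: (_ < _)%O.
Qed.

(** Here three of the six edges, [ac], [bc] and [ce], are read in opposite directions, which cancels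
    against the three negations. *)
Lemma kappa_minus_one a b c e : uniq [:: a; b; c; e] -> kappa m a b c e = false.
Proof.
move=> U; rewrite /kappa !negative_minus_one; try by move: U; split_uniq; solve_uniq.
have N (s t : V) : s != t -> (s < t)%O = ~~ (t < s)%O.
  by move=> st; rewrite -leNgt le_eqVlt (negPf st).
move: U; split_uniq.
have -> := N c a ltac:(solve_uniq); have -> := N e c ltac:(solve_uniq).
have -> := N c b ltac:(solve_uniq).
by do 6!case: (_ < _)%O.
Qed.

End MinusOne.

(** * Faces of a cube *)

Section Q3.

Definition ax0 : 'I_3 := @Ordinal 3 0 isT.
Definition ax1 : 'I_3 := @Ordinal 3 1 isT.
Definition ax2 : 'I_3 := @Ordinal 3 2 isT.

Definition v3 (b0 b1 b2 : bool) : Q3 :=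
  [ffun a : 'I_3 => if a == ax0 then b0 else if a == ax1 then b1 else b2].

Lemma I3P (a : 'I_3) : [\/ a = ax0, a = ax1 | a = ax2].
Proof.
by case: a => [[|[|[|//]]] H]; [apply: Or31|apply: Or32|apply: Or33]; apply: val_inj.
Qed.

Lemma v3K (x : Q3) : v3 (x ax0) (x ax1) (x ax2) = x.
Proof. by apply/ffunP=> a; rewrite ffunE; case: (I3P a) => ->. Qed.

Lemma Q3_adjE (x y : Q3) :
  Q3_adj x y = ((x ax0 != y ax0) + (x ax1 != y ax1) + (x ax2 != y ax2) == 1)%N.
Proof.
rewrite /Q3_adj cardsE -sum1_card big_mkcond /= !big_ord_recl big_ord0 /= addn0 addnA.
have -> : lift ord0 ord0 = ax1 by apply: val_inj.
have -> : lift ord0 (lift ord0 ord0) = ax2 by apply: val_inj.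
have -> : ord0 = ax0 by apply: val_inj.
rewrite !unfold_in.
by do 3!case: (_ != _).
Qed.

(* The vertex with coordinates u, w of the face {x | x a = b}. *)
Definition face_vertex (a : 'I_3) (b u w : bool) : Q3 :=
  if a == ax0 then v3 b u w else if a == ax1 then v3 u b w else v3 u w b.

Lemma face_vertexE a b u w : face_vertex a b u w a = b.
Proof. by rewrite /face_vertex; case: (I3P a) => ->; rewrite /= ffunE. Qed.

Lemma face_vertexP (x : Q3) a : exists u w, x = face_vertex a (x a) u w.
Proof.
by rewrite -{1}(v3K x) /face_vertex; case: (I3P a) => ->; do 2!eexists.
Qed.

Lemma face_vertex_adj a b u w u' w' :
  Q3_adj (face_vertex a b u w) (face_vertex a b u' w') = ((u != u') + (w != w') == 1)%N.
Proof.
by rewrite Q3_adjE /face_vertex; case: (I3P a) => ->; rewrite /= !ffunE /= eqxx ?addn0.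
Qed.

Lemma face_vertex_inj a b u w u' w' :
  face_vertex a b u w = face_vertex a b u' w' -> (u, w) = (u', w').
Proof.
rewrite /face_vertex; case: (I3P a) => -> /= /ffunP E; have := E ax0; have := E ax1;
  have := E ax2;
  by rewrite !ffunE /= => *; congr (_, _).
Qed.

(** The vertices [x] and [z] differ in exactly two coordinates, and [y], [w] are their two common
    neighbours, so the third coordinate is constant. *)
Lemma Q3_four_cycle (x y z w : Q3) : Q3_adj x y -> Q3_adj y z -> Q3_adj z w -> Q3_adj w x ->
  x != z -> y != w -> exists a, [/\ y a = x a, z a = x a & w a = x a].
Proof.
move=> xy yz zw wx xz yw.
suff : [\/ [/\ y ax0 = x ax0, z ax0 = x ax0 & w ax0 = x ax0],
           [/\ y ax1 = x ax1, z ax1 = x ax1 & w ax1 = x ax1] |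
           [/\ y ax2 = x ax2, z ax2 = x ax2 & w ax2 = x ax2]].
  by case=> H; [exists ax0|exists ax1|exists ax2].
have neqE (s t : Q3) : s != t -> ((s ax0 != t ax0) || (s ax1 != t ax1) || (s ax2 != t ax2)).
  by apply: contraNT; rewrite !negb_or !negbK -andbA => /and3P[/eqP e0 /eqP e1 /eqP e2];
    rewrite -(v3K s) e0 e1 e2 v3K.
move: xy yz zw wx (neqE _ _ xz) (neqE _ _ yw); rewrite !Q3_adjE.
move: (x ax0) (x ax1) (x ax2) (y ax0) (y ax1) (y ax2) (z ax0) (z ax1) (z ax2) (w ax0) (w ax1)
  (w ax2).
move=> x0 x1 x2 y0 y1 y2 + + + w0 w1 w2.
have xorP (s t : bool) : (s != t) = s (+) t by case: s; case: t.
rewrite !xorP; move=> z0 z1 z2.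
case: x0; case: x1; case: x2; case: y0; case: y1; case: y2 => //= _;
  case: z0; case: z1; case: z2 => //= _; case: w0; case: w1; case: w2 => //= _ _ _ _;
  by [apply: Or31|apply: Or32|apply: Or33].
Qed.
End Q3.

Section CubeFaces.
Variable V : finType.
Implicit Type phi : {ffun Q3 -> V}.

Lemma face_edgesE phi a b : face_edges phi a b =
  square_edges (phi (face_vertex a b false false)) (phi (face_vertex a b false true))
    (phi (face_vertex a b true true)) (phi (face_vertex a b true false)).
Proof.
apply/setP=> e; apply/imsetP/idP.
  case=> -[x y]; rewrite !inE /= => /and3P[xy /eqP xb /eqP yb] ->.
  have [u [w xE]] := face_vertexP x a; have [u' [w' yE]] := face_vertexP y a.
  move: xy; rewrite xE yE xb yb face_vertex_adj.
  by case: u {xE}; case: w; case: u' {yE}; case: w' => //= _;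
    rewrite ?eqxx ?orbT // setUC ?eqxx ?orbT.
rewrite !inE => /orP[/orP[/orP[]|]|] /eqP ->.
- by exists (face_vertex a b false false, face_vertex a b false true);
  rewrite // inE /= face_vertex_adj !face_vertexE !eqxx.
- by exists (face_vertex a b false true, face_vertex a b true true);
  rewrite // inE /= face_vertex_adj !face_vertexE !eqxx.
- by exists (face_vertex a b true true, face_vertex a b true false);
  rewrite // inE /= face_vertex_adj !face_vertexE !eqxx.
by exists (face_vertex a b true false, face_vertex a b false false);
  rewrite // inE /= face_vertex_adj !face_vertexE !eqxx.
Qed.

Lemma four_cycle_edges phi x y z w : Q3_adj x y -> Q3_adj y z -> Q3_adj z w -> Q3_adj w x ->
  x != z -> y != w -> exists a b, square_edges (phi x) (phi y) (phi z) (phi w) = face_edges phi a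
    b.
Proof.
move=> xy yz zw wx xz yw; have [a [ya za wa]] := Q3_four_cycle xy yz zw wx xz yw.
exists a, (x a); rewrite face_edgesE.
have [u1 [w1 xE]] := face_vertexP x a; have [u2 [w2 yE]] := face_vertexP y a.
have [u3 [w3 zE]] := face_vertexP z a; have [u4 [w4 wE]] := face_vertexP w a.
rewrite ya in yE; rewrite za in zE; rewrite wa in wE.
move: (x a) xE yE zE wE xy yz zw wx xz yw => b -> -> -> -> {x y z w ya za wa};
  rewrite !face_vertex_adj.
have S := square_edges_rot; have R := square_edges_rev.
case: u1; case: w1; case: u2; case: w2 => //= _; case: u3; case: w3 => //= _;
  case: u4; case: w4 => //= _ _; rewrite ?eqxx // => _ _.
all: by [ | rewrite S | rewrite 2!S | rewrite 3!S | rewrite R | rewrite R S | rewrite R 2!S |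
  rewrite R 3!S].
Qed.

Lemma face_uniq phi a b : injective phi ->
  uniq [:: phi (face_vertex a b false false); phi (face_vertex a b false true);
    phi (face_vertex a b true true); phi (face_vertex a b true false)].
Proof.
move=> inj; rewrite /= !inE !(inj_eq inj).
have N u w u' w' : (u, w) != (u', w') -> (face_vertex a b u w == face_vertex a b u' w') = false.
  by move=> n; apply: contraNF n => /eqP /face_vertex_inj ->.
by rewrite !N // !negbT.
Qed.

Definition face phi (inj : injective phi) a b : square V := sq (face_uniq a b inj).

Lemma val_face phi (inj : injective phi) a b : val (face inj a b) = face_edges phi a b.
Proof. by rewrite face_edgesE. Qed.

(** No automorphism of the cube graph is constructed: a face of another labelling [psi] consists of
    four edges of the cube, hence is a four-cycle for [phi], and [four_cycle_edges] makes it a face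
    of [phi]. *)
Lemma is_faceP (q : cube V) phi (c : square V) : is_labelling (val q) phi ->
  reflect (exists a b, val c = face_edges phi a b) (is_face q c).
Proof.
move=> lab; apply: (iffP idP); last first.
  case=> a [b E]; apply/existsP; exists phi; apply/existsP; exists a.
  by apply/existsP; exists b; rewrite lab E eqxx.
case/existsP=> psi /existsP[a /existsP[b /andP[/andP[/injectiveP ipsi /eqP qpsi] /eqP ->]]].
case/andP: lab => /injectiveP iphi /eqP qphi; rewrite qphi in qpsi.
have edge x y : Q3_adj x y -> exists x' y', [/\ Q3_adj x' y', psi x = phi x' & psi y = phi y'].
  move=> xy; have : [set psi x; psi y] \in cube_edges phi.
    by rewrite qpsi; apply/imsetP; exists (x, y); rewrite ?inE.
  case/imsetP=> -[x' y']; rewrite inE /= => xy' /set2_eqP[[-> ->]|[-> ->]].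
    by exists x', y'.
  exists y', x'; split=> //; move: xy'; rewrite !Q3_adjE.
  by rewrite (eq_sym (x' ax0)) (eq_sym (x' ax1)) (eq_sym (x' ax2)).
rewrite face_edgesE.
set x := face_vertex a b false false; set y := face_vertex a b false true.
set z := face_vertex a b true true; set w := face_vertex a b true false.
have [x1 [y1 [xy1 xE yE]]] := edge x y ltac:(by rewrite face_vertex_adj).
have [y2 [z1 [yz1 yE' zE]]] := edge y z ltac:(by rewrite face_vertex_adj).
have [z2 [w1 [zw1 zE' wE]]] := edge z w ltac:(by rewrite face_vertex_adj).
have [w2 [x2 [wx1 wE' xE']]] := edge w x ltac:(by rewrite face_vertex_adj).
move: yz1 zw1 wx1.
(* The edges were lifted through [phi] one by one; injectivity makes the lifts agree at the common
   vertices. *)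
have <- : y1 = y2 by apply: iphi; rewrite -yE.
have <- : z1 = z2 by apply: iphi; rewrite -zE.
have <- : w1 = w2 by apply: iphi; rewrite -wE.
have <- : x1 = x2 by apply: iphi; rewrite -xE.
move=> yz1 zw1 wx1; rewrite xE yE zE wE; apply: four_cycle_edges => //.
  by apply/eqP=> E; have := congr1 phi E; rewrite -xE -zE => /ipsi/face_vertex_inj.
by apply/eqP=> E; have := congr1 phi E; rewrite -yE -wE => /ipsi/face_vertex_inj.
Qed.

Lemma face_edges_inj phi a b a' b' : injective phi -> face_edges phi a b = face_edges phi a' b' ->
  (a, b) = (a', b').
Proof.
move=> inj E.
have sub (x : Q3) : x a' = b' -> x a = b.
  move=> xa'; have [u [w xE]] := face_vertexP x a'.
  move: E; rewrite !face_edgesE => E.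
  have : (phi x) \in cover (square_edges (phi (face_vertex a b false false))
    (phi (face_vertex a b false true))
    (phi (face_vertex a b true true)) (phi (face_vertex a b true false))).
    rewrite E xE xa'; apply/bigcupP.
    by case: u {xE}; case: w;
      [exists [set phi (face_vertex a' b' false true); phi (face_vertex a' b' true true)]
      |exists [set phi (face_vertex a' b' true true); phi (face_vertex a' b' true false)]
      |exists [set phi (face_vertex a' b' false false); phi (face_vertex a' b' false true)]
      |exists [set phi (face_vertex a' b' false false); phi (face_vertex a' b' false true)]];
      rewrite !inE eqxx ?orbT.
  case/bigcupP=> e; rewrite !inE => /orP[/orP[/orP[]|]|] /eqP ->; rewrite !inE =>
    /orP[] /eqP /inj ->;
    exact: face_vertexE.
have [aE|aN] := eqVneq a a'.
  by rewrite aE in sub *; rewrite -(sub (face_vertex a' b' false false)) ?face_vertexE.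
(* If the axes differ, these two opposite vertices of the second face have different coordinates
   along [a], so they cannot both lie on the first face. *)
have := (sub (face_vertex a' b' false false), sub (face_vertex a' b' true true)).
rewrite !face_vertexE => -[/(_ erefl) + /(_ erefl)].
move: aN; rewrite /face_vertex; case: (I3P a) => ->; case: (I3P a') => -> //= _;
  by rewrite !ffunE /= => <-.
Qed.
End CubeFaces.

Lemma face_productE (V : finType) (g : square V -> int) (q : cube V) (phi : {ffun Q3 -> V}) :
  (forall c, g c \in mu2) -> is_labelling (val q) phi ->
  (face_product g q == -1) = cube_sum (negative g) (fun b0 b1 b2 => phi (v3 b0 b1 b2)).
Proof.
move=> g2 lab; have /andP[/injectiveP inj _] := lab.
pose s := [seq face inj p.1 p.2 | p <-
  [:: (ax0, false); (ax0, true); (ax1, false); (ax1, true); (ax2, false); (ax2, true)]].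
have us : uniq s.
  rewrite map_inj_uniq // => -[a b] [a' b'] /(congr1 val); rewrite !val_face.
  exact: face_edges_inj.
have -> : face_product g q = \prod_(c <- s) g c.
  rewrite big_uniq //; apply: eq_bigl => c; apply/(is_faceP c lab)/mapP.
    case=> a [b E]; exists (a, b); last by apply: val_inj; rewrite val_face.
    by case: (I3P a) => ->; case: b {E}; rewrite !inE eqxx ?orbT.
  by case=> -[a b] _ ->; exists a, b; rewrite val_face.
rewrite !big_cons big_nil mulr1.
have sgn c : g c = (-1) ^+ (g c == -1).
  by move: (g2 c); rewrite !inE => /orP[] /eqP ->.
pose face_bit a b := negative g (phi (face_vertex a b false false))
  (phi (face_vertex a b false true))
    (phi (face_vertex a b true true)) (phi (face_vertex a b true false)).
have gE a b : g (face inj a b) = (-1) ^+ face_bit a b.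
  by rewrite /face_bit (negativeE g (face_uniq a b inj)) [LHS]sgn.
rewrite !gE; have -> : cube_sum (negative g) (fun b0 b1 b2 => phi (v3 b0 b1 b2)) =
  face_bit ax0 false (+) face_bit ax0 true (+) face_bit ax1 false (+) face_bit ax1 true (+)
    face_bit ax2 false (+) face_bit ax2 true by [].
move: (face_bit ax0 _) (face_bit ax0 _) (face_bit ax1 _) (face_bit ax1 _) (face_bit ax2 _)
  (face_bit ax2 _).
by do 6!case; rewrite !(expr0, expr1, mulr1, mul1r, mulN1r, opprK).
Qed.

(** * The action of permutations *)

Section PermAction.
Variable V : finType.

(** A uniformly random permutation moves a point to a uniform one if the action is transitive: the
    count is the same for all starting points, and summed over them each permutation contributes
    [#|P|]. *)
Lemma sum_perm_orbit (T : finType) (to : {perm V} -> T -> T) (P : pred T) x :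
  (forall s t y, to t (to s y) = to (s * t)%g y) -> (forall y, to 1%g y = y) ->
  (forall y z, exists s, to s y = z) ->
  ((\sum_(s : {perm V}) P (to s x)) * #|T| = #|P| * #|{perm V}|)%N.
Proof.
move=> toM to1 trans.
have inj s : injective (to s) by apply: (can_inj (g := to s^-1%g)) => y; rewrite toM mulgV to1.
have const y : (\sum_(s : {perm V}) P (to s x) = \sum_(s : {perm V}) P (to s y))%N.
  have [t <-] := trans x y; rewrite (reindex_inj (mulgI t)) /=.
  by apply: eq_bigr => s _; rewrite toM.
transitivity (\sum_(y : T) \sum_(s : {perm V}) P (to s y))%N.
  by rewrite mulnC -sum_nat_const; apply: eq_bigr => y _; exact: const.
rewrite exchange_big mulnC -sum_nat_const; apply: eq_bigr => s _ /=.
rewrite -sum1_card [RHS]big_mkcond [RHS](reindex_inj (inj s)) /=.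
by apply: eq_bigr => y _; rewrite unfold_in; case: (P _).
Qed.

Lemma perm_extension (s t : seq V) : uniq s -> uniq t -> size s = size t ->
  exists p : {perm V}, map p s = t.
Proof.
elim: s t => [|x s IH] [|y t] //=; first by exists 1%g.
case/andP=> xs us /andP[yt ut] [/(IH _ us ut)[p pE]].
(* The transposition corrects the image of [x] and fixes the images of the other entries, which
   differ from [p x] and from [y]. *)
exists (p * tperm (p x) y)%g; rewrite permM tpermL; congr (_ :: _).
rewrite -pE; apply/eq_in_map => z zs; rewrite permM tpermD //.
  by rewrite (inj_eq perm_inj); apply: contraNneq xs => ->.
by apply: contraNneq yt => ->; rewrite -pE map_f.
Qed.

Definition edges_act (p : {perm V}) (E : {set {set V}}) :
  {set {set V}} := [set p @: e | e : {set V} in E].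

Lemma edges_actM p q E : edges_act q (edges_act p E) = edges_act (p * q)%g E.
Proof.
rewrite /edges_act -imset_comp; apply: eq_imset => e /=.
by rewrite -imset_comp; apply: eq_imset => x; rewrite permM.
Qed.

Lemma edges_act1 E : edges_act 1%g E = E.
Proof.
rewrite /edges_act -[RHS]imset_id; apply: eq_imset => e /=.
by rewrite -[RHS]imset_id; apply: eq_imset => x; rewrite perm1.
Qed.

Lemma edges_act_square p i j k l : edges_act p (square_edges i j k l) = square_edges (p i) (p j)
  (p k) (p l).
Proof. by rewrite /edges_act /square_edges !(imsetU, imset_set1). Qed.

Lemma edges_act_cube p (phi : {ffun Q3 -> V}) :
  edges_act p (cube_edges phi) = cube_edges [ffun x => p (phi x)].
Proof.
rewrite /edges_act /cube_edges -imset_comp; apply: eq_imset => -[x y] /=.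
by rewrite imsetU !imset_set1 !ffunE.
Qed.

Lemma edges_act_is_square p (c : square V) : is_square (edges_act p (val c)).
Proof.
have [i [j [k [l [u ->]]]]] := squareP c; rewrite edges_act_square; apply: square_edgesP.
by rewrite -[X in uniq X]/(map p [:: i; j; k; l]) map_inj_uniq //; apply: perm_inj.
Qed.

Lemma edges_act_is_cube p (q : cube V) : is_cube (edges_act p (val q)).
Proof.
case: q => E /= /existsP[phi /andP[/injectiveP inj /eqP ->]]; rewrite edges_act_cube.
apply/existsP; exists [ffun x => p (phi x)]; rewrite /is_labelling eqxx andbT.
by apply/injectiveP => x y; rewrite !ffunE => /perm_inj/inj.
Qed.

Definition square_act p (c : square V) :
  square V := exist _ (edges_act p (val c)) (edges_act_is_square p c).
Definition cube_act p (q : cube V) :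
  cube V := exist _ (edges_act p (val q)) (edges_act_is_cube p q).

Lemma square_act_inj p : injective (square_act p).
Proof.
apply: (can_inj (g := square_act p^-1%g)) => c; apply: val_inj.
by rewrite /= edges_actM mulgV edges_act1.
Qed.

Lemma cube_act_trans (q r : cube V) : exists p, cube_act p q = r.
Proof.
case: q => E Eq; case: r => F Fr.
have /existsP[phi /andP[/injectiveP iphi /eqP EE]] := Eq.
have /existsP[psi /andP[/injectiveP ipsi /eqP FE]] := Fr.
have [p pE] : exists p : {perm V}, map p (map phi (enum Q3)) = map psi (enum Q3).
  by apply: perm_extension; rewrite ?size_map // map_inj_uniq // enum_uniq.
exists p; apply: val_inj; rewrite /= EE FE edges_act_cube; congr cube_edges.
apply/ffunP => x; rewrite ffunE.
move: pE; rewrite -map_comp => /eq_in_map E2; apply: (E2 x); exact: mem_enum.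
Qed.

Lemma sum_perm_cube (g : square V -> int) (phi : {ffun Q3 -> V}) :
  (forall c, g c \in mu2) -> injective phi ->
  ((\sum_(p : {perm V}) cube_sum (negative g) (fun b0 b1 b2 => p (phi (v3 b0 b1 b2)))) * #|cube V|
    = #|[pred q : cube V | (face_product g q == -1)%R]| * #|{perm V}|)%N.
Proof.
move=> g2 inj.
have cphi : is_cube (cube_edges phi).
  by apply/existsP; exists phi; rewrite /is_labelling eqxx andbT; apply/injectiveP.
pose q0 : cube V := exist _ (cube_edges phi) cphi.
rewrite -(@sum_perm_orbit _ cube_act _ q0).
- congr (_ * _)%N; apply: eq_bigr => p _; congr nat_of_bool; rewrite /=.
  rewrite (@face_productE _ _ _ [ffun x => p (phi x)] g2).
    by rewrite /cube_sum /= !ffunE.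
  rewrite /is_labelling /= edges_act_cube eqxx andbT.
  by apply/injectiveP => x y; rewrite !ffunE => /perm_inj/inj.
- by move=> s t y; apply: val_inj; rewrite /= edges_actM.
- by move=> y; apply: val_inj; rewrite /= edges_act1.
exact: cube_act_trans.
Qed.

End PermAction.

(** * Reference vertices *)

(** The formula needs a reading of the square, so one is picked; the default 0 never occurs, since
    every square has a reading. *)
Definition square_potential (V : finType) (eps : int) (f : V -> V -> int) (c : square V) : int :=
  if [pick t : V * V * V * V | let: (i, j, k, l) := t in
        uniq [:: i; j; k; l] && (val c == square_edges i j k l)] is Some (i, j, k, l)
  then eps * f i j * f k j * f k l * f i l else 0.

Lemma square_potentialE (V : finType) eps (f : V -> V -> int) i j k l (u : uniq [:: i; j; k; l]) :
  (forall x y, x != y -> f x y = f y x) ->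
  square_potential eps f (sq u) = eps * f i j * f k j * f k l * f i l.
Proof.
move=> fC; rewrite /square_potential.
case: pickP => [[[[i' j'] k'] l'] /andP[u' /eqP E]|/(_ (i, j, k, l))]; last by rewrite u eqxx.
move: (u); rewrite /= !inE !negb_or -!andbA !andbT => /and5P[ij _ il jk /andP[_ kl]].
have := square_edges_inj u u' E; rewrite !inE !xpair_eqE.
have eji := fC _ _ ij; have ekj := fC _ _ jk; have elk := fC _ _ kl; have eil := fC _ _ il.
by do 7?[case/orP=> [/andP[/andP[/andP[/eqP -> /eqP ->] /eqP ->] /eqP ->]|]];
  last (case/andP=> [/andP[/andP[/eqP -> /eqP ->] /eqP ->] /eqP ->]);
  rewrite ?eji ?ekj ?elk ?eil; ring.
Qed.

Section Reference.
Variables (d : Order.disp_t) (V : finOrderType d) (g : square V -> int).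
Hypothesis g2 : forall c, g c \in mu2.
Local Notation h := (negative g).
Local Notation m := (negative (@minus_one d V)).

(* Since [-1] has theta = 1 and kappa = 0, and the sign -1 has theta = kappa = 1,
   these are the powers of the sign and of [-1] that make theta and kappa vanish
   at the reference vertices. *)
Definition ref_sign a b c e := kappa h a b c e.
Definition ref_twist a b c e x := kappa h a b c e (+) theta h a b c e x.
(** The explicit primitive is known to be symmetric only where cube conditions hold. Reading each
    pair in increasing order makes it symmetric on all of [V]. *)
Definition ref_edge a b c e x i j :=
  let f := ref_primitive (normalized h m (ref_sign a b c e) (ref_twist a b c e x)) a b c in
  if (i < j)%O then f i j else f j i.

Definition ref_square a b c e x : square V -> int :=
  square_potential ((-1) ^+ ref_sign a b c e) (fun i j => (-1) ^+ ref_edge a b c e x i j).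
Definition twisted a b c e x (s : square V) := if ref_twist a b c e x then minus_one s * g s else
  g s.

Lemma ref_edgeC a b c e x i j : i != j -> ref_edge a b c e x i j = ref_edge a b c e x j i.
Proof. by rewrite /ref_edge neq_lt => /orP[] ij; rewrite ij (lt_gtF ij). Qed.

Lemma octuple_inj (T : finType) (o p r x q y z v : T) b0 b1 b2 c0 c1 c2 :
  uniq [:: o; p; r; x; q; y; z; v] ->
  octuple o p r x q y z v b0 b1 b2 = octuple o p r x q y z v c0 c1 c2 ->
    (b0, b1, b2) = (c0, c1, c2).
Proof.
move=> U E.
pose s := [:: o; p; r; x; q; y; z; v].
have nthE e0 e1 e2 : octuple o p r x q y z v e0 e1 e2 = nth o s (4 * e0 + 2 * e1 + e2)%N.
  by case: e0; case: e1; case: e2.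
have lt8 (e0 e1 e2 : bool) : (4 * e0 + 2 * e1 + e2 < size s)%N by case: e0; case: e1; case: e2.
move: E; rewrite !nthE => /eqP; rewrite (nth_uniq o (lt8 _ _ _) (lt8 _ _ _) U).
by case: b0; case: b1; case: b2; case: c0; case: c1; case: c2.
Qed.

(** The exact theorem [cube_closed_primitive] is applied to the subtype of [X]. Its explicit
    formulas only evaluate [h] and [m] at the named vertices, so they give the same result in [X] as
    in [V]. *)
Lemma twisted_eq_ref_square (X : {set V}) a b c e x i j k l (u : uniq [:: i; j; k; l]) :
  (9 <= #|X|)%N -> uniq [:: a; b; c; e; x] -> {subset [:: a; b; c; e; x; i; j; k; l] <= X} ->
  (forall psi : {ffun Q3 -> V}, injective psi -> (forall y, psi y \in X) ->
     cube_sum h (fun b0 b1 b2 => psi (v3 b0 b1 b2)) = false) ->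
  twisted a b c e x (sq u) = ref_square a b c e x (sq u).
Proof.
move=> cX U sub good.
pose T : finType := {y : V | y \in X}.
have inX y : y \in [:: a; b; c; e; x; i; j; k; l] -> exists y' : T, y = val y'.
  by move=> yX; exists (exist _ y (sub y yX)).
have [a' aE] := inX a ltac:(by rewrite !inE eqxx ?orbT).
have [b' bE] := inX b ltac:(by rewrite !inE eqxx ?orbT).
have [c' cE] := inX c ltac:(by rewrite !inE eqxx ?orbT).
have [e' eE] := inX e ltac:(by rewrite !inE eqxx ?orbT).
have [x' xE] := inX x ltac:(by rewrite !inE eqxx ?orbT).
have [i' iE] := inX i ltac:(by rewrite !inE eqxx ?orbT).
have [j' jE] := inX j ltac:(by rewrite !inE eqxx ?orbT).
have [k' kE] := inX k ltac:(by rewrite !inE eqxx ?orbT).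
have [l' lE] := inX l ltac:(by rewrite !inE eqxx ?orbT).
subst a b c e x i j k l.
have uniq4 (s : seq T) : uniq (map val s) = uniq s by rewrite map_inj_uniq //; apply: val_inj.
pose hT (y z w t : T) := h (val y) (val z) (val w) (val t).
pose mT (y z w t : T) := m (val y) (val z) (val w) (val t).
have hcube : cube_closed hT.
  move=> o p r x q y z v U8.
  pose psi : {ffun Q3 -> V} := [ffun s : Q3 =>
    val (octuple o p r x q y z v (s ax0) (s ax1) (s ax2))].
  rewrite -[RHS](good psi).
  - by rewrite /cube_sum /= !ffunE.
  - move=> s t; rewrite !ffunE => /val_inj/(octuple_inj U8)[e0 e1 e2].
    by rewrite -(v3K s) e0 e1 e2 v3K.
  by move=> s; rewrite ffunE; apply: valP.
have cT : (9 <= #|T|)%N by rewrite card_sig.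
have [||||||fC fE] := @cube_closed_primitive T hT mT a' b' c' e' x' _ _ _ _ _ _ cT hcube
  (etrans (esym (uniq4 [:: a'; b'; c'; e'; x'])) U).
- by move=> *; apply: negative_rot.
- by move=> *; apply: negative_rev.
- by move=> *; apply: negative_rot.
- by move=> *; apply: negative_rev.
- by move=> p q r s t V5; apply: theta_minus_one; move: V5; rewrite -uniq4.
- by move=> p q r s V4; apply: kappa_minus_one; move: V4; rewrite -uniq4.
pose f (y z : T) := ref_edge (val a') (val b') (val c') (val e') (val x') (val y) (val z).
pose F := ref_primitive (normalized hT mT (kappa hT a' b' c' e')
  (kappa hT a' b' c' e' (+) theta hT a' b' c' e' x')) a' b' c'.
have FC y z : y != z -> F y z = F z y by exact: fC.
have fval y z : y != z -> F y z = f y z.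
  move=> yz; rewrite /f /ref_edge.
  have E p q : ref_primitive (normalized h m (ref_sign (val a') (val b') (val c') (val e'))
      (ref_twist (val a') (val b') (val c') (val e') (val x'))) (val a') (val b') (val c')
        (val p) (val q) =
      F p q.
    have N (y1 y2 y3 y4 : T) : uniq [:: val y1; val y2; val y3; val y4] = uniq
      [:: y1; y2; y3; y4] :=
      uniq4 [:: y1; y2; y3; y4].
    by rewrite /F /ref_primitive /normalized !N !val_eqE.
  by rewrite (E y z) (E z y) (FC y z yz) if_same.
rewrite /ref_square square_potentialE; last by move=> y z yz; rewrite ref_edgeC.
have gE s : g s = (-1) ^+ (g s == -1) by move: (g2 s); rewrite !inE => /orP[] /eqP ->.
have mE s : minus_one s = (-1) ^+ (@minus_one d V s == -1) by rewrite /minus_one; case: ifP.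
have V4 : uniq [:: i'; j'; k'; l'] by rewrite -uniq4.
have key : h (val i') (val j') (val k') (val l') (+)
  (ref_twist (val a') (val b') (val c') (val e') (val x')
    && m (val i') (val j') (val k') (val l')) =
    ref_sign (val a') (val b') (val c') (val e') (+) f i' j' (+) f j' k' (+) f k' l' (+) f l' i'.
  by move: (fE i' j' k' l' V4); rewrite -/F !fval; try by move: V4; split_uniq; solve_uniq.
move: key; rewrite (negativeE _ u) (negativeE _ u) -/(f i' j').
have -> : ref_edge (val a') (val b') (val c') (val e') (val x') (val k') (val j') = f j' k'.
  by apply: ref_edgeC; move: u; split_uniq; solve_uniq.
have -> : ref_edge (val a') (val b') (val c') (val e') (val x') (val i') (val l') = f l' i'.
  by apply: ref_edgeC; move: u; split_uniq; solve_uniq.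
rewrite -/(f k' l') -!signr_addb => <-.
rewrite /twisted signr_addb -gE.
by case: (ref_twist _ _ _ _ _); rewrite /= ?mulr1 // -mE mulrC.
Qed.
End Reference.

(** * Averaging *)

Lemma card_Q3 : #|Q3| = 8%N.
Proof. by rewrite card_ffun card_bool card_ord. Qed.

Section Averaging.
Variables (d : Order.disp_t) (V : finOrderType d) (g : square V -> int).
Hypothesis g2 : forall c, g c \in mu2.
Let bad_square (a b c e x : V) (s : square V) := twisted g a b c e x s != ref_square g a b c e x
  s.
Let bad_cubes := #|[pred q : cube V | face_product g q == -1]|.

(** This is a union bound over the maps of the cube into the at most thirteen vertices of [X]: a bad
    square forces one of these cubes to fail, and each is moved to a uniform cube. The vertices [y1]
    to [y4] keep [X] at size nine or more even if [s] meets the reference. *)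
Lemma sum_bad_square a b c e x y1 y2 y3 y4 (s : square V) :
  uniq [:: a; b; c; e; x; y1; y2; y3; y4] ->
  ((\sum_(p : {perm V}) bad_square (p a) (p b) (p c) (p e) (p x) (square_act p s)) * #|cube V|
    <= 13 ^ #|Q3| * bad_cubes * #|{perm V}|)%N.
Proof.
move=> U; have [i [j [k [l [u sE]]]]] := squareP s.
pose X := [set y in [:: a; b; c; e; x; y1; y2; y3; y4] ++ [:: i; j; k; l]].
have cX : (#|X| <= 13)%N by rewrite cardsE; apply: card_size.
have cX9 : (9 <= #|X|)%N.
  by apply: (uniq_leq_card U) => y yU; rewrite inE mem_cat yU.
pose emb (phi : {ffun Q3 -> V}) := (phi \in ffun_on (mem X)) && injectiveb phi.
pose bad (p : {perm V}) (phi : {ffun Q3 -> V}) :=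
  cube_sum (negative g) (fun b0 b1 b2 => p (phi (v3 b0 b1 b2))).
have step (p : {perm V}) : (bad_square (p a) (p b) (p c) (p e) (p x) (square_act p s) <=
  \sum_(phi | emb phi) bad p phi)%N.
  case: (boolP [forall phi, emb phi ==> ~~ bad p phi]) => [/forallP good|]; last first.
    rewrite negb_forall => /existsP[phi]; rewrite negb_imply negbK => /andP[ephi bphi].
    by rewrite (bigD1 phi) //= bphi (leq_trans (leq_b1 _)) // leq_addr.
  suff -> : bad_square (p a) (p b) (p c) (p e) (p x) (square_act p s) = false by [].
  have up (t : seq V) : uniq t -> uniq (map p t) by rewrite map_inj_uniq //; apply: perm_inj.
  pose u' : uniq [:: p i; p j; p k; p l] := up [:: i; j; k; l] u.
  have -> : square_act p s = sq u' by apply: val_inj; rewrite sE /= edges_act_square.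
  apply/negbTE; rewrite negbK; apply/eqP.
  apply: (@twisted_eq_ref_square _ _ _ g2 (p @: X)); rewrite ?card_imset //; try exact: perm_inj.
  - by apply: (up [:: a; b; c; e; x]); move: U; split_uniq; solve_uniq.
  - move=> z zs; have /mapP[y yX ->] : z \in map p ([:: a; b; c; e; x] ++ [:: i; j; k; l]) := zs.
    apply: imset_f; rewrite in_set mem_cat; move: yX; rewrite mem_cat => /orP[yX|->];
      last by rewrite orbT.
    by rewrite (mem_subseq (prefix_subseq _ [:: y1; y2; y3; y4]) yX).
  move=> psi ipsi psiX.
  pose phi : {ffun Q3 -> V} := [ffun y => p^-1%g (psi y)].
  have /implyP ephi := good phi.
  have : emb phi.
    apply/andP; split.
      apply/ffun_onP => y; rewrite ffunE; have /imsetP[z zX ->] := psiX y.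
      by rewrite permK.
    by apply/injectiveP => y z; rewrite !ffunE => /perm_inj/ipsi.
  by move/ephi/negbTE; rewrite /bad /phi /cube_sum !ffunE !permKV => ->.
apply: (@leq_trans (\sum_(phi | emb phi) (\sum_(p : {perm V}) bad p phi) * #|cube V|)%N).
  by rewrite -big_distrl /= exchange_big leq_mul2r leq_sum ?orbT.
apply: (@leq_trans (\sum_(phi | emb phi) bad_cubes * #|{perm V}|)%N).
  by apply: leq_sum => phi /andP[_ /injectiveP inj]; rewrite sum_perm_cube.
rewrite sum_nat_const mulnA leq_mul2r; apply/orP; right; rewrite leq_mul2r; apply/orP; right.
have emb_card : (#|emb| <= #|X| ^ #|Q3|)%N.
  rewrite -(card_ffun_on Q3 (mem X)); apply: subset_leq_card.
  by apply/subsetP => phi /andP[].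
by apply: leq_trans emb_card _; rewrite leq_exp2r // card_Q3.
Qed.

Lemma exists_good_reference : (9 <= #|V|)%N -> exists a b c e x,
  (#|[pred s | bad_square a b c e x s]| * #|cube V| <= #|square V| * (13 ^ #|Q3| * bad_cubes))%N.
Proof.
move=> cV.
have [a [b [c [e [x [y1 [y2 [y3 [y4 U]]]]]]]]] : exists a b c e x y1 y2 y3 y4 : V,
    uniq [:: a; b; c; e; x; y1; y2; y3; y4].
  have := take_uniq 9 (enum_uniq V); have := @size_takel 9 _ (enum V); rewrite -cardE => /(_ cV).
  move: (take _ _) => [|a [|b [|c [|e [|x [|y1 [|y2 [|y3 [|y4 [|]]]]]]]]]] // _ U.
  by exists a, b, c, e, x, y1, y2, y3, y4.
pose K := (#|square V| * (13 ^ #|Q3| * bad_cubes))%N.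
pose N (p : {perm V}) := #|[pred s | bad_square (p a) (p b) (p c) (p e) (p x) s]|.
suff [p pK] : exists p, (N p * #|cube V| <= K)%N.
  by exists (p a), (p b), (p c), (p e), (p x).
apply/existsP; apply: contraT; rewrite negb_exists => /forallP big.
have : (\sum_(p : {perm V}) N p * #|cube V| <= K * #|{perm V}|)%N.
  rewrite -big_distrl /= /K.
  (* For each [p] the squares are reindexed by [p] itself, so that the square and the reference move
     together. *)
  have -> : (\sum_(p : {perm V}) N p = \sum_(s : square V) \sum_(p : {perm V})
      bad_square (p a) (p b) (p c) (p e) (p x) (square_act p s))%N.
    rewrite exchange_big; apply: eq_bigr => p _ /=.
    rewrite /N -sum1_card big_mkcond (reindex_inj (@square_act_inj _ p)) /=.
    by apply: eq_bigr => s _; rewrite unfold_in /=; case: (bad_square _ _ _ _ _ _).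
  rewrite big_distrl /= -!mulnA -sum_nat_const; apply: leq_sum => s _; rewrite mulnA.
  exact: sum_bad_square U.
(* If every [p] exceeded [K], the sum would be at least [K.+1] times the number of permutations. *)
apply: contraLR => _; rewrite -ltnNge mulnC.
apply: (@leq_trans (#|{perm V}| * K.+1)%N).
  by rewrite ltn_pmul2l //; apply/card_gt0P; exists 1%g.
by rewrite -sum_nat_const; apply: leq_sum => p _; rewrite ltnNge big.
Qed.

End Averaging.

(** * Existence of cubes and squares, and the final estimate *)

Lemma card_cube_gt0 (V : finType) : (8 <= #|V|)%N -> (0 < #|cube V|)%N.
Proof.
rewrite -{1}card_Q3 => le; apply/card_gt0P.
pose phi : {ffun Q3 -> V} := [ffun x => enum_val (widen_ord le (enum_rank x))].
suff cphi : is_cube (cube_edges phi) by exists (exist _ (cube_edges phi) cphi).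
apply/existsP; exists phi; rewrite /is_labelling eqxx andbT.
apply/injectiveP => x y; rewrite !ffunE => /enum_val_inj/(congr1 val) E.
by apply/enum_rank_inj/val_inj; apply: E.
Qed.

Lemma card_square_gt0 (V : finType) : (8 <= #|V|)%N -> (0 < #|square V|)%N.
Proof.
move=> /card_cube_gt0/card_gt0P[[E /existsP[phi /andP[/injectiveP inj _]]] _].
by apply/card_gt0P; exists (face inj ax0 true).
Qed.

Theorem theorem2p2 (R : realType) :
  exists omega : R, 0 < omega /\
    forall (d : Order.disp_t) (V : finOrderType d) (p : R)
           (g : square V -> int),
      (10 <= #|V|)%N ->
      0 <= p ->
      (forall c : square V, g c \in mu2) ->
      fails_cube_condition_at_most g p ->
      exists g1 : square V -> int,
        (g1 = g \/ g1 = (fun c : square V => minus_one c * g c)) /\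
        exists (eps : int) (f : V -> V -> int) (g' : square V -> int),
          [/\ eps \in mu2,
              (forall i j : V, i != j -> f i j \in mu2 /\ f i j = f j i),
              (forall (i j k l : V) (u : uniq [:: i; j; k; l]),
                 g' (sq u) = eps * f i j * f k j * f k l * f i l) &
              Pr R (fun c : square V => g1 c != g' c) <= omega^-1 * p].
Proof.
pose N : R := (13 ^ #|Q3|)%:R.
have N_gt0 : 0 < N by rewrite /N ltr0n expn_gt0.
(* The constant is the inverse of the number of maps from the eight cube vertices to thirteen
   vertices. *)
exists N^-1; rewrite invr_gt0; split=> // d V p g cV p_ge0 g2 cube_g; rewrite invrK.
have [a [b [c [e [x le_bad]]]]] := exists_good_reference g2 (ltnW cV).
have mu2_sign (s : bool) : (-1) ^+ s \in mu2 by case: s.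
have cC i j : i != j -> (-1 : int) ^+ ref_edge g a b c e x i j = (-1) ^+ ref_edge g a b c e x j i.
  by move=> ij; rewrite ref_edgeC.
exists (twisted g a b c e x); split.
  by rewrite /twisted; case: ref_twist; [right|left].
exists ((-1) ^+ ref_sign g a b c e), (fun i j => (-1) ^+ ref_edge g a b c e x i j),
  (ref_square g a b c e x).
split.
- exact: mu2_sign.
- by move=> i j ij; split; [apply: mu2_sign | apply: cC].
- by move=> i j k l u; rewrite /ref_square square_potentialE.
have cube_gt0 : (0 < #|cube V|)%N by apply: card_cube_gt0; apply: leq_trans cV.
have le_cube : Pr R (fun q : cube V => face_product g q == -1) <= p by exact: cube_g.
apply: (le_trans _ (ler_wpM2l (ltW N_gt0) le_cube)); rewrite /Pr.
have square_gt0 : (0 < #|square V|)%N by apply: card_square_gt0; apply: leq_trans cV.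
(* Clearing the positive denominators leaves the integer inequality of [exists_good_reference]. *)
rewrite ler_pdivrMr ?ltr0n ?square_gt0 // mulrA mulrAC ler_pdivlMr ?ltr0n ?cube_gt0 //.
by rewrite /N -!natrM ler_nat [leqRHS]mulnC; apply: le_bad.
Qed.
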